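(* Let $n\geq 2$. There is a short exact sequence $$1 \to \mathbb{Z}^{n(n-1)/2} \to B_n/[P_n,P_n] \stackrel{\overline{\sigma}}{\to} S_n \to 1,$$ and the middle group $B_n/[P_n,P_n]$ is a crystallographic group.
   Context: $B_n$ is the Artin braid group with generators $\sigma_1,\ldots,\sigma_{n-1}$ and relations $\sigma_i\sigma_j=\sigma_j\sigma_i$ for $|i-j|\geq 2$, and $\sigma_{i+1}\sigma_i\sigma_{i+1}=\sigma_i\sigma_{i+1}\sigma_i$ for $1\leq i\leq n-2$. $S_n$ is the symmetric group, with permutations composed from left to right. $\sigma\colon B_n\to S_n$ is the homomorphism with $\sigma(\sigma_i)=(i,i+1)$, $P_n=\ker\sigma$ is the pure braid group, $[P_n,P_n]$ is its commutator subgroup, and $\overline{\sigma}\colon B_n/[P_n,P_n]\to S_n$ is the homomorphism induced by $\sigma$. A crystallographic group of dimension $d$ is a discrete and uniform (cocompact) subgroup of $\mathbb{R}^d\rtimes \operatorname{O}(d,\mathbb{R})\subseteq \operatorname{Aff}(\mathbb{R}^d)$; an abstract group is said to be crystallographic if, for some $d$, it is isomorphic to such a subgroup. *)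

(* Defs.v *)
From HB Require Import structures.
From mathcomp Require Import all_boot all_order all_algebra all_fingroup.
From mathcomp Require Import generic_quotient zify.
From mathcomp Require Import all_classical all_reals all_analysis.

Set Implicit Arguments.
Unset Strict Implicit.
Unset Printing Implicit Defensive.

Import Algebra numFieldNormedType.Exports.
Local Open Scope classical_set_scope.
Local Open Scope quotient_scope.
Local Open Scope group_scope.

(* The groups at hand are infinite: subgroups are classical sets in a groupType,
   not the {group gT} of finite group theory. *)
Definition is_subgroup (G : groupType) (H : set G) : Prop :=
  [/\ H 1, forall x y, H x -> H y -> H (x * y) & forall x, H x -> H x^-1].

Record subgroup (G : groupType) := Subgroup {
  carrier : set G;
  subgroupP : is_subgroup carrier }.

Record normal_subgroup (G : groupType) := NormalSubgroup {
  normal_group :> subgroup G;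
  normalP : forall x y : G,
    carrier normal_group x -> carrier normal_group (x ^ y) }.

Section CosetSpace.
Variables (G : groupType) (H : subgroup G).

(* x and y are related when xH = yH *)
Definition lcoset_rel (x y : G) : bool := `[< carrier H (x^-1 * y) >].

Lemma lcoset_rel_refl : reflexive lcoset_rel.
Proof. by move=> x; apply/asboolP; rewrite mulVg; case: (subgroupP H). Qed.

Lemma lcoset_rel_sym : symmetric lcoset_rel.
Proof.
have [_ _ HV] := subgroupP H.
by move=> x y; apply/asboolP/asboolP => /HV; rewrite invgM invgK.
Qed.

Lemma lcoset_rel_trans : transitive lcoset_rel.
Proof.
have [_ HM _] := subgroupP H.
move=> y x z /asboolP xy /asboolP yz; apply/asboolP.
by have := HM _ _ xy yz; rewrite -mulgA mulVKg.
Qed.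

Canonical lcoset_equiv :=
  EquivRel lcoset_rel lcoset_rel_refl lcoset_rel_sym lcoset_rel_trans.

Definition lcoset_space := {eq_quot lcoset_rel}.

HB.instance Definition _ := Choice.on lcoset_space.
HB.instance Definition _ := EqQuotient.on lcoset_space.

End CosetSpace.

Section QuotientGroup.
Variables (G : groupType) (N : normal_subgroup G).

Definition quotg : Type := lcoset_space N.

HB.instance Definition _ := Choice.on quotg.
HB.instance Definition _ := EqQuotient.on quotg.

Definition quotg_one : quotg := \pi_quotg 1.
Definition quotg_mul (a b : quotg) : quotg := \pi_quotg (repr a * repr b).
Definition quotg_inv (a : quotg) : quotg := \pi_quotg (repr a)^-1.

Lemma quotg_piP (x y : G) : \pi_quotg x = \pi_quotg y <-> carrier N (x^-1 * y).
Proof. by split=> [/eqmodP/asboolP|Nxy] //; apply/eqmodP/asboolP. Qed.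

Lemma quotg_repr (x : G) : carrier N (x^-1 * repr (\pi_quotg x)).
Proof. by apply/quotg_piP; rewrite reprK. Qed.

Lemma quotg_mulE (x y : G) :
  quotg_mul (\pi_quotg x) (\pi_quotg y) = \pi_quotg (x * y).
Proof.
have [_ NM _] := subgroupP N; apply/esym/quotg_piP.
have := NM _ _ (normalP y (quotg_repr x)) (quotg_repr y).
by rewrite conjgE invgM !mulgA mulgK.
Qed.

Lemma quotg_invE (x : G) : quotg_inv (\pi_quotg x) = \pi_quotg x^-1.
Proof.
apply/quotg_piP; have := normalP x^-1 (quotg_repr x).
by rewrite conjgE !invgK !mulgA mulgV mul1g.
Qed.

Fact quotg_mulA : associative quotg_mul.
Proof.
by move=> x y z; elim/quotW: x => x; elim/quotW: y => y; elim/quotW: z => z;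
  rewrite (quotg_mulE x y) (quotg_mulE y z) !quotg_mulE mulgA.
Qed.

Fact quotg_mul1 : left_id quotg_one quotg_mul.
Proof. by move=> x; elim/quotW: x => x; rewrite quotg_mulE mul1g. Qed.

Fact quotg_mulr1 : right_id quotg_one quotg_mul.
Proof. by move=> x; elim/quotW: x => x; rewrite quotg_mulE mulg1. Qed.

Fact quotg_mulV : left_inverse quotg_one quotg_inv quotg_mul.
Proof. by move=> x; elim/quotW: x => x; rewrite quotg_invE quotg_mulE mulVg. Qed.

Fact quotg_mulrV : right_inverse quotg_one quotg_inv quotg_mul.
Proof. by move=> x; elim/quotW: x => x; rewrite quotg_invE quotg_mulE mulgV. Qed.

HB.instance Definition _ := isGroup.Build quotg
  quotg_mulA quotg_mul1 quotg_mulr1 quotg_mulV quotg_mulrV.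


Fact quotg_pi_morphism : monoid_morphism (\pi_quotg : G -> quotg).
Proof. by split=> // x y; rewrite -quotg_mulE. Qed.

HB.instance Definition _ :=
  isUMagmaMorphism.Build G quotg (\pi_quotg) quotg_pi_morphism.

Section Lift.
Variables (K : groupType) (f : UMagmaMorphism.type G K).
Hypothesis fN : forall x, carrier N x -> f x = 1.

(* The proof argument lets the morphism instance below be inferred. *)
Definition quotg_lift (_ : forall x, carrier N x -> f x = 1) (a : quotg) : K :=
  f (repr a).

Lemma quotg_liftE (x : G) : quotg_lift fN (\pi_quotg x) = f x.
Proof.
by have := fN (quotg_repr x); rewrite gmulfM gmulfV => /mulg1_eq; rewrite invgK.
Qed.

Fact quotg_lift_morphism : monoid_morphism (quotg_lift fN).
Proof.
split; first by rewrite quotg_liftE gmulf1.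
move=> x y; elim/quotW: x => x; elim/quotW: y => y.
by rewrite -[_ * _]/(quotg_mul _ _) quotg_mulE !quotg_liftE gmulfM.
Qed.

HB.instance Definition _ :=
  isUMagmaMorphism.Build quotg K (quotg_lift fN) quotg_lift_morphism.

End Lift.
End QuotientGroup.

Section Presentation.
Variable I : choiceType.

(* The letter (i, false) stands for the generator i, (i, true) for its inverse. *)
Definition word := seq (I * bool).

Definition letter_inv (l : I * bool) : I * bool := (l.1, ~~ l.2).
Definition word_inv (w : word) : word := rev (map letter_inv w).

(* R u v is the defining relation u = v. *)
Variable R : word -> word -> Prop.

Inductive pres_cong : word -> word -> Prop :=
| pres_refl u : pres_cong u u
| pres_sym u v : pres_cong u v -> pres_cong v u
| pres_trans v u w : pres_cong u v -> pres_cong v w -> pres_cong u w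
| pres_cat u u' v v' :
    pres_cong u u' -> pres_cong v v' -> pres_cong (u ++ v) (u' ++ v')
| pres_cancel l : pres_cong [:: l; letter_inv l] [::]
| pres_relator u v : R u v -> pres_cong u v.

Definition pres_rel (u v : word) : bool := `[< pres_cong u v >].

Lemma pres_rel_refl : reflexive pres_rel.
Proof. by move=> u; apply/asboolP/pres_refl. Qed.

Lemma pres_rel_sym : symmetric pres_rel.
Proof. by move=> u v; apply/asboolP/asboolP => /pres_sym. Qed.

Lemma pres_rel_trans : transitive pres_rel.
Proof.
by move=> v u w /asboolP uv /asboolP vw; apply/asboolP/(pres_trans uv vw).
Qed.

Canonical pres_equiv :=
  EquivRel pres_rel pres_rel_refl pres_rel_sym pres_rel_trans.

(* The group presented by < I | R >. *)
Definition presg : Type := {eq_quot pres_rel}.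

HB.instance Definition _ := Choice.on presg.
HB.instance Definition _ := EqQuotient.on presg.

Definition presg_one : presg := \pi_presg [::].
Definition presg_mul (a b : presg) : presg := \pi_presg (repr a ++ repr b).
Definition presg_inv (a : presg) : presg := \pi_presg (word_inv (repr a)).

Lemma presg_piP (u v : word) : \pi_presg u = \pi_presg v <-> pres_cong u v.
Proof. by split=> [/eqmodP/asboolP|uv] //; apply/eqmodP/asboolP. Qed.

Lemma presg_repr (u : word) : pres_cong (repr (\pi_presg u)) u.
Proof. by apply/presg_piP; rewrite reprK. Qed.

Lemma letter_invK : involutive letter_inv.
Proof. by case=> i b; rewrite /letter_inv negbK. Qed.

Lemma word_invK : involutive word_inv.
Proof.
by move=> w; rewrite /word_inv map_rev revK -map_comp map_id_in// => l _ /=;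
  rewrite letter_invK.
Qed.

Lemma pres_mulrV w : pres_cong (w ++ word_inv w) [::].
Proof.
elim: w => [|l w IHw]; first exact: pres_refl.
have -> : (l :: w) ++ word_inv (l :: w)
    = [:: l] ++ ((w ++ word_inv w) ++ [:: letter_inv l]).
  by rewrite {1}/word_inv /= rev_cons -cats1 catA.
apply: pres_trans (pres_cancel l); apply: (@pres_cat _ [:: l] _ [:: _]).
  exact: pres_refl.
exact: (pres_cat IHw (pres_refl _)).
Qed.

Lemma pres_mulV w : pres_cong (word_inv w ++ w) [::].
Proof. by rewrite -{2}(word_invK w); apply: pres_mulrV. Qed.

Lemma presg_mulE u v : presg_mul (\pi_presg u) (\pi_presg v) = \pi_presg (u ++ v).
Proof. by apply/presg_piP/pres_cat; apply: presg_repr. Qed.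

Fact presg_mulA : associative presg_mul.
Proof.
by move=> u v w; elim/quotW: u => u; elim/quotW: v => v; elim/quotW: w => w;
  rewrite (presg_mulE u v) (presg_mulE v w) !presg_mulE catA.
Qed.

Fact presg_mul1 : left_id presg_one presg_mul.
Proof. by move=> u; elim/quotW: u => u; rewrite presg_mulE. Qed.

Fact presg_mulr1 : right_id presg_one presg_mul.
Proof. by move=> u; elim/quotW: u => u; rewrite presg_mulE cats0. Qed.

Fact presg_mulV : left_inverse presg_one presg_inv presg_mul.
Proof.
by move=> a; rewrite -{2}(reprK a) presg_mulE; apply/presg_piP/pres_mulV.
Qed.

Fact presg_mulrV : right_inverse presg_one presg_inv presg_mul.
Proof.
by move=> a; rewrite -{1}(reprK a) presg_mulE; apply/presg_piP/pres_mulrV.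
Qed.

HB.instance Definition _ := isGroup.Build presg
  presg_mulA presg_mul1 presg_mulr1 presg_mulV presg_mulrV.

Definition presg_gen (i : I) : presg := \pi_presg [:: (i, false)].

Section Eval.
Variables (K : groupType) (f : I -> K).

Definition eval_word (w : word) : K :=
  \prod_(l <- w) (if l.2 then (f l.1)^-1 else f l.1).

Hypothesis fR : forall u v, R u v -> eval_word u = eval_word v.

Lemma eval_cong u v : pres_cong u v -> eval_word u = eval_word v.
Proof.
elim=> {u v} [//|u v _ -> //|v u w _ -> _ -> //|u u' v v' _ IHu _ IHv|[i b]|//].
  by rewrite /eval_word !big_cat /= -/(eval_word u) -/(eval_word v) IHu IHv.
rewrite /eval_word big_cons big_seq1 big_nil /=.
by case: b => /=; rewrite (mulgV, mulVg).
Qed.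

Definition presg_lift (_ : forall u v, R u v -> eval_word u = eval_word v)
  (a : presg) : K := eval_word (repr a).

Lemma presg_liftE u : presg_lift fR (\pi_presg u) = eval_word u.
Proof. exact/eval_cong/presg_repr. Qed.

Lemma presg_lift_gen i : presg_lift fR (presg_gen i) = f i.
Proof. by rewrite presg_liftE /eval_word big_seq1. Qed.

Fact presg_lift_morphism : monoid_morphism (presg_lift fR).
Proof.
split; first by rewrite presg_liftE /eval_word big_nil.
move=> u v; elim/quotW: u => u; elim/quotW: v => v; rewrite -[_ * _]/(presg_mul _ _) presg_mulE.
by rewrite !presg_liftE /eval_word big_cat.
Qed.

HB.instance Definition _ :=
  isUMagmaMorphism.Build presg K (presg_lift fR) presg_lift_morphism.

End Eval.
End Presentation.

Section Kernel.
Variables (G K : groupType) (f : UMagmaMorphism.type G K).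

Fact ker_subgroup : is_subgroup [set x | f x = 1].
Proof.
split=> [|x y|x] /=; rewrite ?gmulf1 // ?gmulfM ?gmulfV.
  by move=> -> ->; rewrite mulg1.
by move=> ->; rewrite invg1.
Qed.

Fact ker_normal x y : f x = 1 -> f (x ^ y) = 1.
Proof. by rewrite gmulfJ => ->; rewrite conj1g. Qed.

Definition kerg : normal_subgroup G :=
  @NormalSubgroup G (Subgroup ker_subgroup) ker_normal.

End Kernel.

Section CommutatorSubgroup.
Variables (G : groupType) (N : normal_subgroup G).

Definition comm_set : set G :=
  smallest (@is_subgroup G)
    [set [~ x, y] | x in carrier N & y in carrier N].

Fact comm_subgroup : is_subgroup comm_set.
Proof.
split=> [|x y Cx Cy|x Cx] H [HS HC]; have [H1 HM HV] := HS => //.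
  by apply: HM; [apply: Cx|apply: Cy].
by apply: HV; apply: Cx.
Qed.

Fact comm_normal x y : comm_set x -> comm_set (x ^ y).
Proof.
move=> Cx H [[H1 HM HV] HC].
apply: (Cx [set z | H (z ^ y)]); split; first split=> /=.
- by rewrite conj1g.
- by move=> a b Ha Hb; rewrite conjMg; apply: HM.
- by move=> a Ha; rewrite conjVg; apply: HV.
move=> _ [a Na [b Nb <-]] /=; rewrite conjRg; apply: HC.
by exists (a ^ y); [apply: normalP|exists (b ^ y); [apply: normalP|]].
Qed.

(* [N, N] as a subgroup of G; it is normal in G because N is. *)
Definition commutator_subgroup : normal_subgroup G :=
  @NormalSubgroup G (Subgroup comm_subgroup) comm_normal.

Lemma comm_sub_ker (K : groupType) (f : UMagmaMorphism.type G K) :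
  (forall x, carrier N x -> f x = 1) ->
  forall x, carrier commutator_subgroup x -> f x = 1.
Proof.
move=> fN x /(_ (carrier (kerg f))); apply; split; first exact: subgroupP.
by move=> _ [a Na [b Nb <-]] /=; rewrite gmulfR !fN ?commg1.
Qed.

End CommutatorSubgroup.

Section Braid.
Variable n : nat.

(* The index i : 'I_n.-1 (counted from 0) stands for the generator usually
   written sigma_{i+1}. *)
Inductive braid_rel : word 'I_n.-1 -> word 'I_n.-1 -> Prop :=
| braid_far (i j : 'I_n.-1) : (i.+2 <= j)%N || (j.+2 <= i)%N ->
    braid_rel [:: (i, false); (j, false)] [:: (j, false); (i, false)]
| braid_near (i j : 'I_n.-1) : j = i.+1 :> nat ->
    braid_rel [:: (j, false); (i, false); (j, false)]
              [:: (i, false); (j, false); (i, false)].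

Definition braid_group : groupType := presg braid_rel.

Fact ord_low_subproof (i : 'I_n.-1) : (i < n)%N.
Proof. by apply: leq_trans (ltn_ord i) (leq_pred n). Qed.

Fact ord_high_subproof (i : 'I_n.-1) : (i.+1 < n)%N.
Proof. by rewrite -ltn_predRL. Qed.

Definition adj_transp (i : 'I_n.-1) : 'S_n :=
  tperm (Ordinal (ord_low_subproof i)) (Ordinal (ord_high_subproof i)).

Fact braid_perm_subproof u v :
  braid_rel u v -> eval_word adj_transp u = eval_word adj_transp v.
Proof.
rewrite /eval_word; case=> i j ij; rewrite !big_cons !big_nil /= !mulg1.
  apply/commgP/conjg_fixP; rewrite /adj_transp tpermJ.
  by rewrite !tpermD // -val_eqE /=; apply/eqP; move: ij; lia.
have eq_mid : Ordinal (ord_low_subproof j) = Ordinal (ord_high_subproof i).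
  exact/val_inj.
have tJ x y (s : 'S_n) : tperm x y * (s * tperm x y) = s ^ tperm x y.
  by rewrite conjgE tpermV.
rewrite /adj_transp !tJ !tpermJ eq_mid tpermL tpermR !tpermD //.
all: by rewrite -val_eqE /=; apply/eqP; move: ij; lia.
Qed.

(* The product of 'S_n composes permutations from left to right:
   (s * t) x = t (s x). *)
Definition braid_perm : UMagmaMorphism.type braid_group 'S_n :=
  presg_lift braid_perm_subproof.

Lemma braid_perm_gen (i : 'I_n.-1) :
  braid_perm (presg_gen braid_rel i) = adj_transp i.
Proof. exact: presg_lift_gen. Qed.

Definition pure_braid_group : normal_subgroup braid_group := kerg braid_perm.

Definition braid_quot : groupType :=
  quotg (commutator_subgroup pure_braid_group).

Fact braid_quot_perm_subproof x :
  carrier (commutator_subgroup pure_braid_group) x -> braid_perm x = 1.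
Proof. exact: comm_sub_ker. Qed.

Definition braid_quot_perm : UMagmaMorphism.type braid_quot 'S_n :=
  quotg_lift braid_quot_perm_subproof.

Lemma braid_quot_permE (x : braid_group) :
  braid_quot_perm (\pi_braid_quot x) = braid_perm x.
Proof. exact: quotg_liftE. Qed.

End Braid.

Section EuclideanGroup.
Import GRing.Theory.
Variables (R : realType) (d : nat).
Local Open Scope ring_scope.

(* (v, A), with A orthogonal, is the isometry x |-> A x + v of R^d. *)
Record euclid := Euclid {
  euclid_val : ('cV[R]_d * 'M[R]_d)%type;
  euclidP : euclid_val.2^T *m euclid_val.2 == 1%:M }.

HB.instance Definition _ := [isSub for euclid_val].
HB.instance Definition _ := [Choice of euclid by <:].
HB.instance Definition _ :=
  Topological.copy euclid (initial_topology euclid_val).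

Definition euclid_act (g : euclid) (x : 'cV[R]_d) : 'cV[R]_d :=
  (euclid_val g).2 *m x + (euclid_val g).1.

Fact euclid_one_subproof : (1%:M : 'M[R]_d)^T *m 1%:M == 1%:M.
Proof. by rewrite trmx1 mulmx1. Qed.

Fact euclid_mul_subproof (g h : euclid) :
  let B := (euclid_val g).2 *m (euclid_val h).2 in B^T *m B == 1%:M.
Proof.
have /eqP gP := euclidP g; have /eqP hP := euclidP h.
by rewrite /= trmx_mul !mulmxA -(mulmxA _ _ (euclid_val g).2) gP mulmx1 hP.
Qed.

Fact euclid_inv_subproof (g : euclid) :
  let B := (euclid_val g).2^T in B^T *m B == 1%:M.
Proof. by rewrite /= trmxK; apply/eqP/mulmx1C/eqP/euclidP. Qed.

Definition euclid_one : euclid :=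
  @Euclid (0, 1%:M) euclid_one_subproof.
Definition euclid_mul (g h : euclid) : euclid :=
  @Euclid ((euclid_val g).1 + (euclid_val g).2 *m (euclid_val h).1,
           (euclid_val g).2 *m (euclid_val h).2) (euclid_mul_subproof g h).
Definition euclid_inv (g : euclid) : euclid :=
  @Euclid (- ((euclid_val g).2^T *m (euclid_val g).1), (euclid_val g).2^T)
          (euclid_inv_subproof g).

Fact euclid_mulA : associative euclid_mul.
Proof.
by move=> g h k; apply/val_inj; rewrite /= mulmxDr !mulmxA addrA.
Qed.

Fact euclid_mul1 : left_id euclid_one euclid_mul.
Proof. by case=> -[v A] gP; apply/val_inj; rewrite /= !mul1mx add0r. Qed.

Fact euclid_mulr1 : right_id euclid_one euclid_mul.
Proof. by case=> -[v A] gP; apply/val_inj; rewrite /= mulmx1 mulmx0 addr0. Qed.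

Fact euclid_mulV : left_inverse euclid_one euclid_inv euclid_mul.
Proof.
by move=> g; apply/val_inj; rewrite /= addNr; have /eqP -> := euclidP g.
Qed.

Fact euclid_mulrV : right_inverse euclid_one euclid_inv euclid_mul.
Proof.
move=> g; apply/val_inj; have /eqP/mulmx1C gP := euclidP g.
by rewrite /= mulmxN mulmxA gP mul1mx subrr.
Qed.

HB.instance Definition _ := isGroup.Build euclid
  euclid_mulA euclid_mul1 euclid_mulr1 euclid_mulV euclid_mulrV.

Lemma euclid_actM (g h : euclid) :
  euclid_act (g * h)%g = euclid_act g \o euclid_act h.
Proof.
apply/funext => x; rewrite /euclid_act /= mulmxDr mulmxA -addrA.
by rewrite (addrC _ (_ *m _)).
Qed.

(* The first clause is discreteness (every point of H is isolated in H), the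
   second one is uniformity (the space of cosets gH is compact). *)
Definition is_crystallographic_subgroup (H : subgroup euclid) : Prop :=
  isolated (carrier H) = carrier H /\
  compact [set: quotient_topology (lcoset_space H)].

End EuclideanGroup.

Definition crystallographic (R : realType) (G : groupType) : Prop :=
  exists (d : nat) (H : subgroup (euclid R d))
         (f : UMagmaMorphism.type G (euclid R d)),
    [/\ is_crystallographic_subgroup H, injective f & range f = carrier H].

(* Main.v *)
(* Count the strands from 0, and write Q = B_n/[P_n, P_n]. The group S_n acts on
   the n(n-1)/2 pairs of strands. Sending the generator that exchanges i and i+1
   to the corresponding permutation matrix followed by the translation by the
   basis vector e_{i,i+1} respects the braid relations, and pure braids become
   translations; this gives a morphism from Q to the isometries of R^(n(n-1)/2).

   Upper bound on P_n/[P_n, P_n]. As this group is abelian, a conjugate of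
   sigma_1^2 in Q depends only on the permutation of the conjugating element, and
   in fact only on the image p of the pair {0, 1}; call it A_p. The A_p span a
   normal subgroup L of Q, and Q/L satisfies the Coxeter relations of S_n, so
   Q/L -> S_n is injective and L is the whole kernel of Q -> S_n.

   Lower bound. A_p acts as the translation by 2 e_p, so the A_p are independent.

   The isometries in the image have integral coordinates, hence form a discrete
   group, and they contain all the translations by 2 Z^(n(n-1)/2), hence form a
   cocompact one. *)
Require Import Defs.
From HB Require Import structures.
From mathcomp Require Import all_boot all_order all_algebra all_fingroup.
From mathcomp Require Import generic_quotient zify lra.
From mathcomp Require Import all_classical all_reals all_analysis.

Set Implicit Arguments.
Unset Strict Implicit.
Unset Printing Implicit Defensive.

Import Order.TTheory GRing.Theory Num.Theory numFieldNormedType.Exports.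
Local Open Scope classical_set_scope.
Local Open Scope quotient_scope.
Local Open Scope group_scope.

(** * The Coxeter presentation of the symmetric group *)

Section SymmetricPresentation.
Variables (W : groupType) (m : nat) (s : nat -> W).
Hypothesis s_sq : forall i, (i < m)%N -> s i * s i = 1.
Hypothesis s_far : forall i j, (i.+2 <= j)%N -> (j < m)%N ->
  s i * s j = s j * s i.
Hypothesis s_near : forall i, (i.+1 < m)%N ->
  s i.+1 * s i * s i.+1 = s i * s i.+1 * s i.

(* s (l - 1) * ... * s k, a representative of a coset of <s 0, ..., s (l - 2)>
   in <s 0, ..., s (l - 1)>. *)
Fixpoint descent l k : W :=
  if l is l'.+1 then if (k <= l')%N then s l' * descent l' k else 1 else 1.

Lemma descent_full l : descent l l = 1.
Proof. by case: l => //= l; rewrite ltnn. Qed.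

Lemma descentS l k : (k <= l)%N -> descent l.+1 k = s l * descent l k.
Proof. by move=> /= ->. Qed.

Lemma descent_above l k j : (l < j)%N -> (j < m)%N ->
  descent l k * s j = s j * descent l k.
Proof.
move=> lj jm; elim: l lj => [|l IHl] lj /=; first by rewrite mulg1 mul1g.
case: ifP => _; last by rewrite mulg1 mul1g.
by rewrite -mulgA IHl 1?ltnW // !mulgA s_far.
Qed.

Lemma descent_below l k j : (j.+1 < k)%N -> (l <= m)%N ->
  descent l k * s j = s j * descent l k.
Proof.
move=> jk; elim: l => [|l IHl] lm /=; first by rewrite mulg1 mul1g.
case: ifP => kl; last by rewrite mulg1 mul1g.
rewrite -mulgA IHl 1?ltnW // !mulgA -(s_far (i := j)) //.
exact: leq_trans jk kl.
Qed.

Lemma descent_extend l k : (k < l)%N -> descent l k.+1 * s k = descent l k.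
Proof.
elim: l => // l IHl /[!ltnS] kl; rewrite (descentS kl) /=.
case: ltnP => [kl'|lk]; first by rewrite -mulgA IHl.
by have -> : k = l by [lia]; rewrite descent_full mul1g mulg1.
Qed.

Lemma descent_shorten l k : (k < l <= m)%N ->
  descent l k * s k = descent l k.+1.
Proof.
move=> /andP[kl lm]; rewrite -(descent_extend kl) -mulgA s_sq ?mulg1 //.
exact: leq_trans lm.
Qed.

(** Letters above [s j] commute with [s j.-1], so [j] may be taken to be the top letter. There [s j]
    slides left to the top two letters, and the braid relation lowers its index. *)
Lemma descent_inside l k j : (k < j < l)%N -> (l <= m)%N ->
  descent l k * s j = s j.-1 * descent l k.
Proof.
elim: l => [|l IHl] /andP[kj jl] lm; first by [].
rewrite descentS; last by lia.
have [jl'|lj] := ltnP j l.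
  by rewrite -mulgA IHl ?kj ?jl' 1?ltnW // !mulgA (s_far (i := j.-1)) //; lia.
have {lj jl IHl} jl : j = l by [lia]; rewrite {}jl in kj *.
case: l lm kj => // l lm kl.
rewrite !descentS ?leqW // -!mulgA descent_above // !mulgA.
by rewrite s_near.
Qed.

(** A letter acts on the right cosets of the subgroup generated by [s 0, ..., s (l - 1)]: it changes
    the representative when [j] is [k] or [k - 1], and otherwise passes through it, keeping its
    index if below [k - 1] and losing one if above [k]. *)
Lemma descent_mul l k j : (l.+1 <= m)%N -> (k <= l.+1)%N -> (j <= l)%N ->
  (exists2 k', (k' <= l.+1)%N & descent l.+1 k * s j = descent l.+1 k') \/
  exists2 j', (j' < l)%N & descent l.+1 k * s j = s j' * descent l.+1 k.
Proof.
move=> lm kl jl; case: (ltngtP j.+1 k) => [jk|kj|<-].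
- by right; exists j; [lia|apply: descent_below].
- have [kj'|kj'] := eqVneq k j.
    left; exists k.+1; first by rewrite ltnS kj'.
    by rewrite -kj' descent_shorten // ltnS kj' jl.
  by right; exists j.-1; [lia|apply: descent_inside => //; lia].
- by left; exists j; [lia|apply: descent_extend].
Qed.

Definition gprod (u : seq nat) : W := \prod_(i <- u) s i.

Lemma gprod_rcons u j : gprod (rcons u j) = gprod u * s j.
Proof. by rewrite /gprod -cats1 big_cat big_seq1. Qed.

Lemma gprod_descent l u : (l.+1 <= m)%N -> all (fun i => i <= l)%N u ->
  exists v k, [/\ all (fun i => i < l)%N v, (k <= l.+1)%N &
                  gprod u = gprod v * descent l.+1 k].
Proof.
move=> lm; elim/last_ind: u => [|u j IHu].
  by exists [::], l.+1; rewrite descent_full mulg1.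
rewrite all_rcons => /andP[jl /IHu[v [k [vl kl]]]] {IHu}.
rewrite gprod_rcons => ->; rewrite -mulgA.
have [[k' k'l ->]|[j' j'l ->]] := descent_mul lm kl jl; first by exists v, k'.
exists (rcons v j'), k; split=> //; first by rewrite all_rcons; apply/andP.
by rewrite gprod_rcons mulgA.
Qed.

Variable act : nat -> W -> nat.
Hypothesis act1 : forall k, (k <= m)%N -> act k 1 = k.
Hypothesis actM : forall k x y, act k (x * y) = act (act k x) y.
Hypothesis act_low : forall i, (i < m)%N -> act i (s i) = i.+1.
Hypothesis act_high : forall i, (i < m)%N -> act i.+1 (s i) = i.
Hypothesis act_out : forall i k, (i < m)%N -> (k <= m)%N ->
  k != i -> k != i.+1 -> act k (s i) = k.

Lemma act_descent l k : (k <= l <= m)%N -> act l (descent l k) = k.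
Proof.
elim: l => [|l IHl] /andP[]; first by rewrite leqn0 => /eqP-> _; rewrite act1.
rewrite leq_eqVlt => /orP[/eqP-> lm|]; first by rewrite descent_full act1.
rewrite ltnS => kl lm; rewrite descentS // actM act_high //.
by rewrite IHl ?kl 1?ltnW.
Qed.

Lemma act_gprod_fix l v : (l < m)%N -> all (fun i => i < l)%N v ->
  act l.+1 (gprod v) = l.+1.
Proof.
move=> lm; elim: v => [|i v IHv] /=; first by rewrite /gprod big_nil act1.
case/andP=> il vl; rewrite /gprod big_cons -/(gprod v) actM.
by rewrite act_out ?IHv //; lia.
Qed.

(** Letters of index below [l] fix the point [l.+1], whereas [descent l.+1 k] sends it to [k]. If
    the word acts trivially then [k = l.+1], the coset factor is 1, and one generator has been
    eliminated. *)
Lemma coxeter_faithful u : all (fun i => i < m)%N u ->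
  (forall k, (k <= m)%N -> act k (gprod u) = k) -> gprod u = 1.
Proof.
(* Only the bound on the letters varies in the induction; the word keeps acting trivially on all
   points up to [m]. *)
move: (leqnn m); move: {1 3}m => l; elim: l u => [|l IHl] u lm.
  by case: u => // _ _; rewrite /gprod big_nil.
move=> /(gprod_descent lm)[v [k [vl kl uE]]] act_u.
suff kE : k = l.+1.
  move: uE; rewrite kE descent_full mulg1 => uE; rewrite uE.
  by apply: IHl vl _; [apply: ltnW|rewrite -uE].
by have := act_u _ lm; rewrite uE actM act_gprod_fix // act_descent ?kl.
Qed.

End SymmetricPresentation.

(** * Induction and products in a presented group *)

Lemma presg_ind (I : choiceType) (R : word I -> word I -> Prop)
    (H : set (presg R)) :
  is_subgroup H -> (forall i, H (presg_gen R i)) -> forall x, H x.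
Proof.
move=> [H1 HM HV] Hgen; elim/quotW; elim=> [//|[i b] u IHu].
have -> : \pi_(presg R) ((i, b) :: u)
    = (\pi_(presg R) [:: (i, b)] : presg R) * \pi_(presg R) u.
  by rewrite -[_ * _]/(presg_mul _ _) presg_mulE.
apply: HM => //; case: b; last exact: Hgen.
have -> : \pi_(presg R) [:: (i, true)] = (presg_gen R i)^-1; last exact: HV.
apply/esym; rewrite -[LHS]mulg1; apply: canLR (mulKg _) _.
rewrite -[_ * _]/(presg_mul _ _) presg_mulE; apply/esym/presg_piP.
exact: (pres_cancel R (i, false)).
Qed.

Lemma presg_gen_mul (I : choiceType) (r : word I -> word I -> Prop) i u :
  presg_gen r i * \pi_(presg r) u = \pi_(presg r) ((i, false) :: u).
Proof. by rewrite -[_ * _]/(presg_mul _ _) presg_mulE. Qed.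

Lemma presg_gen_mul3 (I : choiceType) (r : word I -> word I -> Prop) i j k :
  presg_gen r i * presg_gen r j * presg_gen r k
    = \pi_(presg r) [:: (i, false); (j, false); (k, false)].
Proof.
rewrite -mulgA (presg_gen_mul r j [:: (k, false)]); exact: presg_gen_mul.
Qed.

(** * The action on pairs and the affine representation *)

Section Pairs.
Variable n : nat.

Definition pairs := {A : {set 'I_n} | #|A| == 2}.

HB.instance Definition _ := Finite.on pairs.

Fact pair_act_subproof (w : 'S_n) (p : pairs) :
  #|[set w x | x in val p]%SET| == 2.
Proof. by rewrite card_imset; [exact: (valP p)|exact: perm_inj]. Qed.

Definition pair_act (w : 'S_n) (p : pairs) : pairs :=
  exist (fun A : {set 'I_n} => #|A| == 2) _ (pair_act_subproof w p).

Lemma pair_act1 p : pair_act 1 p = p.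
Proof.
by apply/val_inj/setP => x; rewrite /= (eq_imset _ (@perm1 _)) imset_id.
Qed.

Lemma pair_actM v w p : pair_act (v * w) p = pair_act w (pair_act v p).
Proof.
by apply/val_inj; rewrite /= -imset_comp; apply: eq_imset => x /=;
  rewrite permM.
Qed.

Lemma pair_actK w : cancel (pair_act w) (pair_act w^-1).
Proof. by move=> p; rewrite -pair_actM mulgV pair_act1. Qed.

Lemma pair_actKV w : cancel (pair_act w^-1) (pair_act w).
Proof. by move=> p; rewrite -pair_actM mulVg pair_act1. Qed.

Lemma card_pairs : #|{: pairs}| = (n * (n - 1) %/ 2)%N.
Proof.
have := card_draws 'I_n 2; rewrite card_ord bin2 -subn1 divn2 => <-.
by rewrite card_sig; apply: eq_card => A; rewrite inE.
Qed.

Definition pair_idx (w : 'S_n) (i : 'I_#|{: pairs}|) : 'I_#|{: pairs}| :=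
  enum_rank (pair_act w (enum_val i)).

Fact pair_idx_inj w : injective (pair_idx w).
Proof.
move=> i j /enum_rank_inj/(can_inj (pair_actK w)); exact: enum_val_inj.
Qed.

Definition pair_perm w : 'S_#|{: pairs}| := perm (@pair_idx_inj w).

Lemma pair_perm1 : pair_perm 1 = 1.
Proof.
by apply/permP => i; rewrite permE perm1 /pair_idx pair_act1 enum_valK.
Qed.

Lemma pair_permM v w : pair_perm (v * w) = pair_perm v * pair_perm w.
Proof.
by apply/permP => i; rewrite permM !permE /pair_idx enum_rankK pair_actM.
Qed.

Lemma pair_permV w : pair_perm w^-1 = (pair_perm w)^-1.
Proof.
by rewrite -[LHS]mulg1 -(mulgV (pair_perm w)) mulgA -pair_permM mulVg
  pair_perm1 mul1g.
Qed.

End Pairs.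

Section PairIsometry.
Variables (R : realType) (n : nat).
Local Open Scope ring_scope.
Local Notation D := #|{: pairs n}|.

Fact pair_iso_subproof (w : 'S_n) :
  (perm_mx (pair_perm w) : 'M[R]_D)^T *m perm_mx (pair_perm w) == 1%:M.
Proof. by rewrite tr_perm_mx -perm_mxM mulVg perm_mx1. Qed.

Definition pair_iso (v : 'cV[R]_D) (w : 'S_n) : euclid R D :=
  @Euclid R D (v, perm_mx (pair_perm w)) (pair_iso_subproof w).

Lemma pair_isoM u v w x : (pair_iso u v * pair_iso w x)%g
  = pair_iso (u + perm_mx (pair_perm v) *m w) (v * x)%g.
Proof. by apply/val_inj; rewrite /= pair_permM perm_mxM. Qed.

Lemma pair_iso1 : pair_iso 0 1%g = 1%g.
Proof. by apply/val_inj; rewrite /= pair_perm1 perm_mx1. Qed.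

Lemma pair_isoV v w : (pair_iso v w)^-1%g
  = pair_iso (- (perm_mx (pair_perm w^-1) *m v)) w^-1%g.
Proof.
by apply/val_inj; rewrite /= pair_permV tr_perm_mx.
Qed.

Definition pair_vec (p : pairs n) : 'cV[R]_D := delta_mx (enum_rank p) 0.

(** The inverse comes from [perm_mx], whose row [i] is the unit row at the image of [i]; this
    convention is multiplicative for left-to-right products. *)
Lemma pair_perm_vec w p :
  perm_mx (pair_perm w) *m pair_vec p = pair_vec (pair_act w^-1 p).
Proof.
apply/matrixP => i j; rewrite -row_permE !mxE permE /pair_idx.
rewrite (inj_eq enum_rank_inj) (can2_eq (pair_actK w) (pair_actKV w)).
by rewrite -(inj_eq enum_rank_inj) enum_valK.
Qed.

End PairIsometry.

(** The adjacent transposition on natural numbers, where equalities of images become arithmetic. *)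
Definition nswap (i k : nat) : nat :=
  if k == i then i.+1 else if k == i.+1 then i else k.

Lemma nswap_lt N i k : (i.+1 < N)%N -> (k < N)%N -> (nswap i k < N)%N.
Proof. by rewrite /nswap; do 2?[case: ifP => _]; lia. Qed.

Lemma nswap_neq i a b : a != b -> nswap i a != nswap i b.
Proof. by rewrite /nswap => ab; repeat case: ifP => ?; lia. Qed.

Section BraidRepresentation.
Variables (R : realType) (m : nat).
Local Notation n := m.+2.
Local Notation D := #|{: pairs n}|.

Lemma adj_transp_inord (i : 'I_n.-1) (k : nat) : (k < n)%N ->
  adj_transp i (inord k) = inord (nswap i k).
Proof.
move=> kn; have im : (i < n.-1)%N by exact: ltn_ord.
have inord_low : Ordinal (ord_low_subproof i) = inord i.
  by apply/val_inj; rewrite /= inordK // ltnS ?(ltnW im) ?im.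
have inord_high : Ordinal (ord_high_subproof i) = inord i.+1.
  by apply/val_inj; rewrite /= inordK // ltnS ?(ltnW im) ?im.
rewrite /adj_transp inord_low inord_high /nswap.
have [->|ki] := eqVneq k i; first by rewrite tpermL.
have [->|ki1] := eqVneq k i.+1; first by rewrite tpermR.
by rewrite tpermD // -val_eqE /= !inordK 1?eq_sym //; exact: ltnW.
Qed.

Fact pair0_subproof : #|[set inord 0; inord 1 : 'I_n]%SET| == 2.
Proof. by rewrite cards2 -val_eqE /= !inordK. Qed.

Definition pair0 : pairs n :=
  exist (fun A : {set 'I_n} => #|A| == 2) _ pair0_subproof.

Definition mkpair (a b : nat) : pairs n :=
  insubd pair0 [set inord a; inord b]%SET.

Lemma val_mkpair a b : (a < n)%N -> (b < n)%N -> a != b ->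
  val (mkpair a b) = [set inord a; inord b]%SET.
Proof.
by move=> an bn ab; rewrite val_insubd cards2 -val_eqE /= !inordK // ab.
Qed.

Lemma mkpairC a b : mkpair a b = mkpair b a.
Proof. by rewrite /mkpair finset.setUC. Qed.

Lemma pair_act_mkpair (i : 'I_n.-1) a b : (a < n)%N -> (b < n)%N -> a != b ->
  pair_act (adj_transp i) (mkpair a b) = mkpair (nswap i a) (nswap i b).
Proof.
move=> an bn ab; apply/val_inj; rewrite /= val_mkpair // val_mkpair.
- by rewrite imsetU1 imset_set1 !adj_transp_inord.
- by apply: nswap_lt => //; apply: (ltn_ord i).
- by apply: nswap_lt => //; apply: (ltn_ord i).
- exact: nswap_neq.
Qed.

Lemma adj_transpV (i : 'I_n.-1) : (adj_transp i)^-1 = adj_transp i.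
Proof. exact: tpermV. Qed.

(* Coordinate {a, b} of the translation part counts, with sign, the crossings
   between the strands a and b. *)
Definition braid_gen_iso (i : 'I_n.-1) : euclid R D :=
  pair_iso (pair_vec R (mkpair i i.+1)) (adj_transp i).

(** Far generators fix each other's pair. In the braid relation both sides translate by the sum of
    the basis vectors of the three pairs among [i], [i.+1], [i.+2], met in opposite orders. *)
Fact braid_iso_subproof u v :
  braid_rel u v -> eval_word braid_gen_iso u = eval_word braid_gen_iso v.
Proof.
move=> uv; have := braid_perm_subproof uv; rewrite /eval_word.
case: uv => i j ij; rewrite !big_cons !big_nil !mulg1 /= => perm_eq.
  rewrite /braid_gen_iso !pair_isoM perm_eq !pair_perm_vec !adj_transpV.
  have im : (i.+1 < n)%N by exact: (ltn_ord i).
  have jm : (j.+1 < n)%N by exact: (ltn_ord j).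
  rewrite !pair_act_mkpair ?(ltnW im) ?(ltnW jm) ?neq_ltn ?ltnSn //.
  by rewrite /nswap; congr (pair_iso _ _); rewrite addrC; congr (_ + _)%R;
    congr (pair_vec _ (mkpair _ _)); do !case: eqP; lia.
rewrite /braid_gen_iso !pair_isoM perm_eq; congr (pair_iso _ _).
rewrite !mulmxDr !pair_perm_vec !adj_transpV.
have im : (i < n)%N by exact: ltnW (ltn_ord i).
have jm : (i.+2 < n)%N by rewrite -ij; exact: (ltn_ord j).
have im1 := ltnW jm.
have nE k : nswap i k =
    if k == i :> nat then i.+1 else if k == i.+1 then (i : nat) else k by [].
have nE' k : nswap j k =
    if k == i.+1 then i.+2 else if k == i.+2 then i.+1 else k by rewrite -ij.
rewrite !ij.
have -> : pair_act (adj_transp j) (mkpair i i.+1) = mkpair i i.+2.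
  rewrite pair_act_mkpair // ?nE' ?eqxx ?ifN //; lia.
have -> : pair_act (adj_transp i) (mkpair i.+1 i.+2) = mkpair i i.+2.
  rewrite pair_act_mkpair // ?nE; last by lia.
  by congr mkpair; do !case: ifP => //; lia.
have -> : pair_act (adj_transp j) (mkpair i i.+2) = mkpair i i.+1.
  rewrite pair_act_mkpair // ?nE'; last by lia.
  by congr mkpair; do !case: ifP => //; lia.
have -> : pair_act (adj_transp i) (mkpair i i.+2) = mkpair i.+1 i.+2.
  rewrite pair_act_mkpair // ?nE; last by lia.
  by congr mkpair; do !case: ifP => //; lia.
by rewrite addrCA [RHS]addrCA; congr (_ + _)%R; apply: addrC.
Qed.

Definition braid_iso : UMagmaMorphism.type (braid_group n) (euclid R D) :=
  presg_lift braid_iso_subproof.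

Lemma braid_iso_gen i : braid_iso (presg_gen _ i) = braid_gen_iso i.
Proof. exact: presg_lift_gen. Qed.

(** Integral translation parts will give discreteness, and a linear part determined by the
    permutation makes pure braids act as translations. Both properties hold for generators and
    survive products and inverses, permutation matrices being integral. *)
Lemma braid_isoE x :
  exists z : 'cV[int]_D,
    braid_iso x = pair_iso (map_mx intr z) (braid_perm n x).
Proof.
pose H : set (braid_group n) := [set x | exists z : 'cV[int]_D,
  braid_iso x = pair_iso (map_mx intr z) (braid_perm n x)].
apply: (@presg_ind _ _ H); first split.
- by exists 0%R; rewrite !gmulf1 map_mx0 pair_iso1.
- move=> x' y' [z xE] [t yE].
  exists (z + perm_mx (pair_perm (braid_perm n x')) *m t)%R.
  by rewrite !gmulfM xE yE pair_isoM map_mxD map_mxM map_perm_mx.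
- move=> x' [z xE].
  exists (- (perm_mx (pair_perm (braid_perm n x')^-1) *m z))%R.
  by rewrite !gmulfV xE pair_isoV map_mxN map_mxM map_perm_mx.
move=> i; exists (delta_mx (enum_rank (mkpair i i.+1)) 0)%R.
by rewrite braid_perm_gen braid_iso_gen map_delta_mx.
Qed.

Lemma pair_isoR u v : [~ pair_iso u 1, pair_iso v 1] = 1 :> euclid R D.
Proof.
have C (a b : 'cV[R]_D) :
    pair_iso a 1 * pair_iso b 1 = pair_iso b 1 * pair_iso a 1.
  by rewrite !pair_isoM pair_perm1 perm_mx1 !mul1mx addrC.
by apply/eqP/commgP/C.
Qed.

Fact braid_quot_iso_subproof x :
  carrier (commutator_subgroup (pure_braid_group n)) x -> braid_iso x = 1.
Proof.
(* The kernel of [braid_iso] is a subgroup, so it is enough that it contains the commutators of pure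
   braids, which become commutators of translations. *)
move=> /(_ (carrier (kerg braid_iso))); apply; split; first exact: subgroupP.
move=> _ [a a1 [b b1 <-]]; rewrite /= gmulfR.
have [z ->] := braid_isoE a; have [t ->] := braid_isoE b.
by rewrite (a1 : braid_perm n a = 1) (b1 : braid_perm n b = 1) pair_isoR.
Qed.

Definition braid_quot_iso : UMagmaMorphism.type (braid_quot n) (euclid R D) :=
  quotg_lift braid_quot_iso_subproof.

Lemma braid_quot_iso_pi (x : braid_group n) :
  braid_quot_iso (\pi_(braid_quot n) x) = braid_iso x.
Proof. exact: quotg_liftE. Qed.

Lemma braid_quot_isoE x : exists z : 'cV[int]_D,
  braid_quot_iso x = pair_iso (map_mx intr z) (braid_quot_perm n x).
Proof.
elim/quotW: x => x; rewrite braid_quot_iso_pi braid_quot_permE.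
exact: braid_isoE.
Qed.

End BraidRepresentation.

(** * The abelianized pure braid group *)

(** Used with [c = 0] for the whole symmetric group and with [c = 2] for the pointwise stabilizer of
    the first two points. *)
Lemma adj_transp_generate n c (H : set 'S_n) :
  is_subgroup H -> (forall i : 'I_n.-1, (c <= i)%N -> H (adj_transp i)) ->
  forall w : 'S_n, (forall x : 'I_n, (x < c)%N -> w x = x) -> H w.
Proof.
move=> [H1 HM HV] Hadj.
have HJ x y : H x -> H y -> H (x ^ y).
  by move=> Hx Hy; rewrite conjgE; exact: HM (HV _ Hy) (HM _ _ Hx Hy).
have Htlt (k : nat) : forall a b : 'I_n, (c <= a)%N ->
    b = (a + k.+1)%N :> nat -> H (tperm a b).
  elim: k => [|k IHk] a b ca bE.
    have an : (a < n.-1)%N by have := ltn_ord b; lia.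
    have -> : tperm a b = adj_transp (Ordinal an).
      by congr tperm; apply/val_inj; rewrite //= bE addn1.
    exact: Hadj.
  have b'n : (a + k.+1 < n)%N by have := ltn_ord b; lia.
  pose b' := Ordinal b'n.
  (* A longer transposition is a shorter one conjugated by an adjacent one. *)
  have -> : tperm a b = tperm a b' ^ tperm b' b.
    by rewrite tpermJ tpermL tpermD // -val_eqE /=; lia.
  apply: HJ; first exact: IHk.
  have b'1 : (b' < n.-1)%N by rewrite /=; have := ltn_ord b; lia.
  have -> : tperm b' b = adj_transp (Ordinal b'1).
    by congr tperm; apply/val_inj; rewrite //= bE addnS.
  by apply: Hadj; rewrite /=; lia.
have Ht (a b : 'I_n) : (c <= a)%N -> (c <= b)%N -> H (tperm a b).
  move=> ca cb; have [ab|ba|/val_inj->] := ltngtP a b.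
  - by apply: (Htlt (b - a.+1)%N); rewrite //; lia.
  - by rewrite tpermC; apply: (Htlt (a - b.+1)%N); rewrite //; lia.
  - by rewrite tperm1.
move=> w; have [k] := ubnP #|[pred x | w x != x]|.
elim: k w => // k IHk w wk w_fix.
have [x wx|w_id] := pickP (fun x => w x != x); last first.
  suff -> : w = 1 by [].
  by apply/permP => x; rewrite perm1; apply/eqP; have /negbFE := w_id x.
have wwx : w (w x) != w x by rewrite (inj_eq perm_inj).
have le_c y : w y != y -> (c <= y)%N.
  by apply: contraR; rewrite -ltnNge => yc; rewrite w_fix.
(* [w'] fixes [x] and every fixed point of [w], so it moves fewer points. *)
pose w' := w * tperm (w x) x.
have w'_fix y : w y = y -> w' y = y.
  move=> wy; rewrite permM wy tpermD //.
    by apply: contraNneq wwx => ->; rewrite wy.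
  by apply: contraNneq wx => ->; rewrite wy.
have -> : w = w' * tperm (w x) x by rewrite -mulgA tperm2 mulg1.
apply: (HM); last exact: Ht (le_c _ wwx) (le_c _ wx).
apply: IHk => [|y yc]; last by rewrite w'_fix ?w_fix.
move: wk; rewrite ltnS; apply: leq_trans; apply/proper_card/properP; split.
  by apply/fintype.subsetP => y; rewrite !inE; apply: contraNneq => /w'_fix->.
by exists x; rewrite inE // permM tpermL eqxx.
Qed.

Section PureQuotient.
Variable m : nat.
Local Notation n := m.+2.
Local Notation Q := (braid_quot n).

Definition qpi (x : braid_group n) : Q := \pi_Q x.

Lemma qpiM x y : qpi (x * y) = qpi x * qpi y.
Proof. exact: gmulfM. Qed.

Lemma qpi1 : qpi 1 = 1.
Proof. exact: gmulf1. Qed.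

Lemma qpiV x : qpi x^-1 = (qpi x)^-1.
Proof. exact: gmulfV. Qed.

Lemma qpi_perm x : braid_quot_perm n (qpi x) = braid_perm n x.
Proof. exact: braid_quot_permE. Qed.

(** Natural indices fit the Coxeter relations above; only [i <= m] is meaningful, since [inord]
    sends other values to 0. *)
Definition qgen (i : nat) : Q := qpi (presg_gen _ (inord i)).

Lemma qgen_perm i : braid_quot_perm n (qgen i) = @adj_transp n (inord i).
Proof. by rewrite qpi_perm braid_perm_gen. Qed.

Lemma qgen_ind (H : set Q) :
  is_subgroup H -> (forall i, (i < m.+1)%N -> H (qgen i)) -> forall x, H x.
Proof.
move=> [H1 HM HV] Hgen; elim/quotW; rewrite -/qpi.
apply: (@presg_ind _ _ [set x | H (qpi x)]) => [|i /=].
  split=> [|x y /= Hx Hy|x /= Hx]; rewrite /= ?qpi1 ?qpiM ?qpiV //.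
    exact: HM.
  exact: HV.
by have := Hgen i (ltn_ord i); rewrite /qgen inord_val.
Qed.

Lemma qgen_far i j : (i.+2 <= j)%N -> (j < m.+1)%N ->
  qgen i * qgen j = qgen j * qgen i.
Proof.
move=> ij jm; rewrite /qgen -!qpiM; congr qpi.
rewrite !presg_gen_mul; apply/presg_piP/pres_relator/braid_far.
by rewrite !inordK ?ij //; lia.
Qed.

Lemma qgen_near i : (i.+1 < m.+1)%N ->
  qgen i.+1 * qgen i * qgen i.+1 = qgen i * qgen i.+1 * qgen i.
Proof.
move=> im; rewrite /qgen -!qpiM; congr qpi.
rewrite !presg_gen_mul3; apply/presg_piP/pres_relator/braid_near.
by rewrite !inordK //; lia.
Qed.

(** The commutator of two pure lifts lies in the subgroup that has been divided out. *)
Lemma pure_commute (x y : Q) : braid_quot_perm n x = 1 ->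
  braid_quot_perm n y = 1 -> x * y = y * x.
Proof.
elim/quotW: x => x; elim/quotW: y => y; rewrite -/(qpi x) -/(qpi y).
rewrite !qpi_perm => x1 y1.
suff: commute (qpi x) (qpi y) by []; apply/commgP/eqP.
have -> : [~ qpi x, qpi y] = qpi [~ x, y].
  by rewrite /commg /conjg !(qpiM, qpiV).
rewrite -qpi1; apply/esym/quotg_piP; rewrite invg1 mul1g.
move=> H [_]; apply; exists x => //; exists y => //.
Qed.

Lemma braid_quot_perm_surj (w : 'S_n) : exists x, braid_quot_perm n x = w.
Proof.
pose H : set 'S_n := range (braid_quot_perm n).
suff [x _ <-] : H w by exists x.
apply: (@adj_transp_generate n 0) => //; first split.
- by exists 1; rewrite ?gmulf1.
- by move=> _ _ [x _ <-] [y _ <-]; exists (x * y); rewrite ?gmulfM.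
- by move=> _ [x _ <-]; exists x^-1; rewrite ?gmulfV.
by move=> i _; exists (qgen i); rewrite // qgen_perm inord_val.
Qed.

End PureQuotient.

Section PureModule.
Variable m : nat.
Local Notation n := m.+2.
Local Notation Q := (braid_quot n).
Local Notation p0 := (pair0 m).

(* The kernel P_n/[P_n, P_n] of B_n/[P_n, P_n] -> S_n, written additively. *)
Record pure_quot := PureQuot {
  pure_val : Q;
  pure_valP : braid_quot_perm n pure_val == 1 }.

HB.instance Definition _ := [isSub for pure_val].
HB.instance Definition _ := [Choice of pure_quot by <:].

Lemma pure_perm (k : pure_quot) : braid_quot_perm n (pure_val k) = 1.
Proof. exact/eqP/pure_valP. Qed.

Fact pure_zero_subproof : braid_quot_perm n 1 == 1.
Proof. by rewrite gmulf1. Qed.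

Fact pure_opp_subproof (k : pure_quot) : braid_quot_perm n (pure_val k)^-1 == 1.
Proof. by rewrite gmulfV pure_perm invg1. Qed.

Fact pure_add_subproof (k l : pure_quot) :
  braid_quot_perm n (pure_val k * pure_val l) == 1.
Proof. by rewrite gmulfM !pure_perm mulg1. Qed.

Definition pure_zero := PureQuot pure_zero_subproof.
Definition pure_opp k := PureQuot (pure_opp_subproof k).
Definition pure_add k l := PureQuot (pure_add_subproof k l).

Fact pure_addA : associative pure_add.
Proof. by move=> k l h; apply/val_inj; rewrite /= mulgA. Qed.

Fact pure_addC : commutative pure_add.
Proof. by move=> k l; apply/val_inj/pure_commute; apply: pure_perm. Qed.

Fact pure_add0 : left_id pure_zero pure_add.
Proof. by move=> k; apply/val_inj; rewrite /= mul1g. Qed.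

Fact pure_addN : left_inverse pure_zero pure_opp pure_add.
Proof. by move=> k; apply/val_inj; rewrite /= mulVg. Qed.

HB.instance Definition _ := GRing.isZmodule.Build pure_quot
  pure_addA pure_addC pure_add0 pure_addN.

Fact pure_conj_subproof (g : Q) (k : pure_quot) :
  braid_quot_perm n (pure_val k ^ g) == 1.
Proof. by rewrite gmulfJ pure_perm conj1g. Qed.

Definition pure_conj g k := PureQuot (pure_conj_subproof g k).

Fact pure_conj_additive g : zmod_morphism (pure_conj g).
Proof. by move=> k l; apply/val_inj; rewrite /= conjMg conjVg. Qed.

HB.instance Definition _ g :=
  GRing.isZmodMorphism.Build pure_quot pure_quot (pure_conj g)
    (pure_conj_additive g).

Lemma pure_conjM g h k : pure_conj (g * h) k = pure_conj h (pure_conj g k).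
Proof. by apply/val_inj; rewrite /= conjgM. Qed.

Lemma pure_conj_pure g k : braid_quot_perm n g = 1 -> pure_conj g k = k.
Proof.
move=> g1; apply/val_inj; rewrite /= conjgE.
by rewrite (pure_commute (pure_perm k) g1) mulKg.
Qed.

(** [g] and [h] differ by a pure element, which acts trivially by conjugation on the abelian kernel;
    so the symmetric group acts on it. *)
Lemma pure_conj_perm g h k :
  braid_quot_perm n g = braid_quot_perm n h -> pure_conj g k = pure_conj h k.
Proof.
move=> gh; rewrite -[g](mulgVK h) pure_conjM; congr pure_conj.
by rewrite pure_conj_pure // gmulfM gmulfV gh mulgV.
Qed.

Fact pure_twist_subproof : braid_quot_perm n (qgen m 0 * qgen m 0) == 1.
Proof. by rewrite gmulfM qgen_perm tperm2. Qed.

Definition pure_twist := PureQuot pure_twist_subproof.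

(* The stabilizer of {0, 1} is generated by the adjacent transpositions other
   than (1 2), and the corresponding generators commute with sigma_1. *)
Lemma pure_twist_stab (w : 'S_n) : pair_act w p0 = p0 ->
  exists2 x, braid_quot_perm n x = w & pure_conj x pure_twist = pure_twist.
Proof.
pose H : set 'S_n := [set w | exists2 x, braid_quot_perm n x = w &
  pure_conj x pure_twist = pure_twist].
have HS : is_subgroup H.
  split.
  - by exists 1; rewrite ?gmulf1 // pure_conj_pure ?gmulf1.
  - move=> _ _ [x <- xt] [y <- yt]; exists (x * y); rewrite ?gmulfM //.
    by rewrite pure_conjM xt yt.
  - move=> _ [x <- xt]; exists x^-1; rewrite ?gmulfV //.
    by rewrite -[in LHS]xt -pure_conjM mulgV pure_conj_pure ?gmulf1.
have [H1 HM HV] := HS.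
have H0 : H (@adj_transp n (inord 0)).
  exists (qgen m 0); first exact: qgen_perm.
  by apply/val_inj; rewrite /= conjgE -mulgA mulKg.
have Hfix (v : 'S_n) : v (inord 0) = inord 0 -> v (inord 1) = inord 1 -> H v.
  move=> v0 v1; apply: (@adj_transp_generate n 2) => // [i i2|x].
    exists (qgen m i); first by rewrite qgen_perm inord_val.
    have im : (i < m.+1)%N by exact: ltn_ord.
    apply/val_inj; rewrite /= conjgE -(mulgA _ _ (qgen m i)) (qgen_far i2 im).
    by rewrite (mulgA _ (qgen m i)) (qgen_far i2 im) -mulgA mulKg.
  case: x => -[|[|//]] xn _.
    by have -> : Ordinal xn = inord 0 by apply/val_inj; rewrite /= inordK.
  by have -> : Ordinal xn = inord 1 by apply/val_inj; rewrite /= inordK.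
move=> wp0.
have : [set w (inord 0); w (inord 1)]%SET = [set inord 0; inord 1]%SET.
  by have /(congr1 val) := wp0; rewrite /= imsetU1 imset_set1.
move=> /setP eq_w; apply: (_ : H w).
have w01 : w (inord 0) != w (inord 1).
  by rewrite (inj_eq perm_inj) -val_eqE /= !inordK.
have tw k : (k < 2)%N -> @adj_transp n (inord 0) (inord k) = inord (1 - k).
  move=> k2; rewrite adj_transp_inord ?(leq_trans k2) // /nswap inordK //.
  by case: k k2 => [|[|]].
have := eq_w (w (inord 0)); have := eq_w (w (inord 1)).
rewrite !inE !eqxx orbT /= => /esym/orP[]/eqP w1 /esym/orP[]/eqP w0.
- by rewrite w0 w1 eqxx in w01.
(* If [w] exchanges 0 and 1, composing it with their transposition fixes both. *)
- have -> : w = w * @adj_transp n (inord 0) * @adj_transp n (inord 0).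
    by rewrite -mulgA tperm2 mulg1.
  by apply: (HM) => //; apply: Hfix; rewrite permM ?w0 ?w1 tw.
- exact: Hfix.
- by rewrite w0 w1 eqxx in w01.
Qed.

Lemma pair_act_trans (p : pairs n) : exists w, pair_act w p0 = p.
Proof.
have /cards2P[x [y [xy pE]]] := valP p.
(* Send 0 to [x] first; [z] is where 1 lands, and it is then sent to [y] without disturbing [x]. *)
pose z := tperm (inord 0) x (inord 1).
have zx : z != x.
  rewrite -[x](tpermL (inord 0)) (inj_eq perm_inj) -val_eqE /= !inordK //.
exists (tperm (inord 0) x * tperm z y); apply/val_inj; rewrite /= pE.
by rewrite imsetU1 imset_set1 !permM -/z !tpermL tpermD // eq_sym.
Qed.

(** The permutation of [x * y^-1] stabilizes the pair {0, 1}, so some lift of it fixes the twist,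
    and then every lift does. This makes [A_p] well defined. *)
Lemma pure_conj_twist x y :
  pair_act (braid_quot_perm n x) p0 = pair_act (braid_quot_perm n y) p0 ->
  pure_conj x pure_twist = pure_conj y pure_twist.
Proof.
move=> xy; have [] := @pure_twist_stab (braid_quot_perm n (x * y^-1)).
  by rewrite gmulfM gmulfV pair_actM xy pair_actK.
move=> z zE zt; rewrite -[x](mulgVK y) pure_conjM; congr pure_conj.
by rewrite -(pure_conj_perm _ zE).
Qed.

Fact pure_gen_subproof p : exists x, pair_act (braid_quot_perm n x) p0 = p.
Proof.
have [w <-] := pair_act_trans p; have [x <-] := braid_quot_perm_surj w.
by exists x.
Qed.

(* The class of the pure braid A_{ij}, where p = {i, j}. *)
Definition pure_gen (p : pairs n) : pure_quot :=
  pure_conj (projT1 (cid (pure_gen_subproof p))) pure_twist.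

Lemma pure_gen_twist x :
  pure_gen (pair_act (braid_quot_perm n x) p0) = pure_conj x pure_twist.
Proof. by apply: pure_conj_twist; case: cid. Qed.

Lemma pure_conj_gen g p :
  pure_conj g (pure_gen p) = pure_gen (pair_act (braid_quot_perm n g) p).
Proof.
have [x <-] := pure_gen_subproof p.
by rewrite pure_gen_twist -pure_conjM -pair_actM -gmulfM pure_gen_twist.
Qed.

Definition pure_lin (z : pairs n -> int) : pure_quot :=
  (\sum_p pure_gen p *~ z p)%R.

Lemma pure_linD z t : pure_lin (z \+ t)%R = (pure_lin z + pure_lin t)%R.
Proof.
by rewrite /pure_lin -big_split; apply: eq_bigr => p _; rewrite mulrzDr.
Qed.

Lemma pure_lin0 : pure_lin (fun=> 0%R) = 0%R.
Proof. by rewrite /pure_lin big1 // => p _; rewrite mulr0z. Qed.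

Lemma pure_linN z : pure_lin (fun p => - z p)%R = (- pure_lin z)%R.
Proof.
by rewrite /pure_lin -sumrN; apply: eq_bigr => p _; rewrite mulrNz.
Qed.

Lemma pure_lin_delta q : pure_lin (fun p => (p == q)%:R)%R = pure_gen q.
Proof.
rewrite /pure_lin (bigD1 q) //= eqxx mulr1z big1 ?addr0 // => p pq.
by rewrite (negbTE pq) mulr0z.
Qed.

Lemma pure_conj_lin g z : pure_conj g (pure_lin z)
  = pure_lin (z \o pair_act (braid_quot_perm n g)^-1).
Proof.
rewrite /pure_lin raddf_sum /=.
rewrite [RHS](reindex_inj (can_inj (pair_actK (braid_quot_perm n g)))) /=.
by apply: eq_bigr => p _; rewrite raddfMz /= pure_conj_gen pair_actK.
Qed.

End PureModule.

(** * The twists span the whole kernel *)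

Section PureSpan.
Variable m : nat.
Local Notation n := m.+2.
Local Notation Q := (braid_quot n).
Local Notation p0 := (pair0 m).

Definition pure_span : set Q :=
  [set x | exists z, x = pure_val (@pure_lin m z)].

Fact pure_span_subgroup : is_subgroup pure_span.
Proof.
split.
- by exists (fun=> 0%R); rewrite pure_lin0.
- by move=> _ _ [z ->] [t ->]; exists (z \+ t)%R; rewrite pure_linD.
- by move=> _ [z ->]; exists (fun p => - z p)%R; rewrite pure_linN.
Qed.

Fact pure_span_normal (x g : Q) : pure_span x -> pure_span (x ^ g).
Proof.
move=> [z ->]; exists (z \o pair_act (braid_quot_perm n g)^-1).
by rewrite -pure_conj_lin.
Qed.

Definition pure_span_group : normal_subgroup Q :=
  @NormalSubgroup Q (Subgroup pure_span_subgroup) pure_span_normal.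

(** All generators are conjugate: for [y = qgen m i.+1 * qgen m i], the braid relation says that
    [qgen m i * y = y * qgen m i.+1]. *)
Lemma qgen_sq_conj i : (i <= m)%N ->
  exists x, qgen m i * qgen m i = (qgen m 0 * qgen m 0) ^ x.
Proof.
elim: i => [|i IHi] im; first by exists 1; rewrite conjg1.
have [x xE] := IHi (ltnW im).
exists (x * (qgen m i.+1 * qgen m i)); rewrite conjgM -xE conjMg.
suff -> : qgen m i ^ (qgen m i.+1 * qgen m i) = qgen m i.+1 by [].
by rewrite conjgE (mulgA (qgen m i)) -(qgen_near im) mulKg.
Qed.

Lemma qgen_sq_span i : (i <= m)%N -> pure_span (qgen m i * qgen m i).
Proof.
move=> /qgen_sq_conj[x ->].
exists (fun p => (p == pair_act (braid_quot_perm n x) p0)%:R)%R.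
by rewrite pure_lin_delta pure_gen_twist.
Qed.

Local Notation W := (quotg pure_span_group).

Definition wpi (x : Q) : W := \pi_W x.

Lemma wpiM x y : wpi (x * y) = wpi x * wpi y.
Proof. exact: gmulfM. Qed.

Lemma wpi1 : wpi 1 = 1.
Proof. exact: gmulf1. Qed.

Lemma wpi_span x : pure_span x <-> wpi x = 1.
Proof.
by rewrite -wpi1; split=> [xL|/esym/quotg_piP]; [apply/esym/quotg_piP|];
  rewrite invg1 mul1g.
Qed.

Fact wperm_subproof x : carrier pure_span_group x -> braid_quot_perm n x = 1.
Proof. by move=> [z ->]; apply: pure_perm. Qed.

Definition wperm : UMagmaMorphism.type W 'S_n := quotg_lift wperm_subproof.

Lemma wperm_wpi x : wperm (wpi x) = braid_quot_perm n x.
Proof. exact: quotg_liftE. Qed.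

Definition wgen i : W := wpi (qgen m i).

(** Dividing by the span of the twists kills the squares, so the braid relations become the Coxeter
    relations. *)
Lemma wgen_sq i : (i < m.+1)%N -> wgen i * wgen i = 1.
Proof. by move=> im; rewrite -wpiM; apply/wpi_span/qgen_sq_span. Qed.

Lemma wgen_far i j : (i.+2 <= j)%N -> (j < m.+1)%N ->
  wgen i * wgen j = wgen j * wgen i.
Proof. by move=> ij jm; rewrite /wgen -!wpiM qgen_far. Qed.

Lemma wgen_near i : (i.+1 < m.+1)%N ->
  wgen i.+1 * wgen i * wgen i.+1 = wgen i * wgen i.+1 * wgen i.
Proof. by move=> im; rewrite /wgen -!wpiM qgen_near. Qed.

(** The generators are now involutions, so the inverse of a word is its reversal and words without
    inverse letters suffice. *)
Lemma wgen_word x : exists2 u, all (fun i => i < m.+1)%N u &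
  wpi x = gprod wgen u.
Proof.
pose H : set Q := [set x | exists2 u, all (fun i => i < m.+1)%N u &
  wpi x = gprod wgen u].
have inv_rev u : all (fun i => i < m.+1)%N u ->
    gprod wgen u * gprod wgen (rev u) = 1.
  elim: u => [|i u IHu]; first by rewrite /gprod big_nil mulg1.
  case/andP=> im um; rewrite rev_cons gprod_rcons {1}/gprod big_cons.
  by rewrite -/(gprod _ u) -mulgA (mulgA (gprod _ u)) IHu // mul1g wgen_sq.
apply: (@qgen_ind m H) => [|i im]; first split.
- by exists [::]; rewrite // /gprod big_nil wpi1.
- move=> y z [u um yE] [v vm zE]; exists (u ++ v); first by rewrite all_cat um.
  by rewrite wpiM yE zE /gprod big_cat.
- move=> y [u um yE]; exists (rev u); first by rewrite all_rev.
  by rewrite -[LHS]mulg1 -(inv_rev u um) -yE mulgA -wpiM mulVg wpi1 mul1g.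
by exists [:: i]; rewrite /= ?im // /gprod big_seq1.
Qed.

Lemma wperm_faithful w : wperm w = 1 -> w = 1.
Proof.
elim/quotW: w => x; rewrite -/(wpi x); have [u um ->] := wgen_word x.
(* [W] acts on the strands 0, ..., m + 1 through [wperm], and [wgen i] exchanges [i] and [i.+1], as
   [coxeter_faithful] requires. *)
move=> u1; pose act (k : nat) (y : W) : nat := wperm y (inord k).
have act_gen i k : (i < m.+1)%N -> (k < n)%N -> act k (wgen i) = nswap i k.
  move=> im kn; rewrite /act wperm_wpi qgen_perm adj_transp_inord // !inordK //.
  exact: nswap_lt.
apply: (@coxeter_faithful W m.+1 wgen _ _ _ act) => //.
- exact: wgen_sq.
- exact: wgen_far.
- exact: wgen_near.
- by move=> k km; rewrite /act gmulf1 perm1 /= inordK.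
- by move=> k y z; rewrite /act gmulfM permM inord_val.
- by move=> i im; rewrite act_gen // /nswap eqxx; case: eqP => //; lia.
- by move=> i k im km /negbTE ki /negbTE ki1; rewrite act_gen // /nswap ki ki1.
by move=> k km; rewrite /act u1 perm1 /= inordK.
Qed.

(** The upper bound: a pure element has trivial permutation, so by faithfulness its class modulo the
    span is trivial. *)
Lemma pure_lin_surj (k : pure_quot m) : exists z, k = pure_lin z.
Proof.
suff [z kz] : pure_span (pure_val k) by exists z; apply/val_inj.
by apply/wpi_span/wperm_faithful; rewrite wperm_wpi pure_perm.
Qed.

End PureSpan.

(** * Discrete and cocompact groups of isometries *)

Section CompactIsometries.
Local Open Scope ring_scope.

(** A filter on [A] is pushed forward by [f]; a cluster point [f x] of the image pulls back to [x],
    since the open sets of the initial topology are preimages. *)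
Lemma initial_compact (S : choiceType) (T : topologicalType) (f : S -> T)
    (A : set S) :
  compact (f @` A) -> compact (A : set (initial_topology f)).
Proof.
move=> Aco F FF FA.
have sub_im B : F B -> F (f @^-1` (f @` B)).
  by apply: filterS => x Bx; exists x.
have [_ [[x Ax <-] clx]] := Aco (f @ F) _ (sub_im _ FA).
exists x; split=> // B V FB [_ [[U Uopen <-] Ux] UV].
have [_ [[y By <-] Uy]] :=
  clx _ _ (sub_im _ FB) (open_nbhs_nbhs (conj Uopen Ux)).
by exists y; split=> //; apply: UV.
Qed.

Variable R : realType.

Lemma entrywise_continuous k l m n (s : 'I_m -> 'I_n -> 'I_k * 'I_l) :
  continuous (fun A : 'M[R]_(k, l) =>
    \matrix_(i < m, j < n) A (s i j).1 (s i j).2).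
Proof.
move=> A U /= /nbhs_ballP[e e0 eU]; apply/nbhs_ballP; exists e => //= B [_ AB].
by apply: eU; split=> // i j; rewrite !mxE.
Qed.

(** Reshaping a row vector is continuous and carries a product of segments onto the box. *)
Lemma box_compact m n (b : R) :
  compact [set A : 'M[R]_(m, n) | forall i j, `|A i j| <= b].
Proof.
pose K := [set u : 'rV[R]_(m * n) | forall k, u ord0 k \in `[- b, b]].
have Kco : compact K.
  apply: (@rV_compact R _ (fun=> [set` `[- b, b]])) => _.
  exact: segment_compact.
pose f (u : 'rV[R]_(m * n)) : 'M[R]_(m, n) :=
  \matrix_(i, j) u ord0 (mxvec_index i j).
have <- : f @` K = [set A : 'M[R]_(m, n) | forall i j, `|A i j| <= b].
  apply/seteqP; split=> [_ [u ub <-] i j|A Ab].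
    by rewrite mxE ler_norml; have := ub (mxvec_index i j); rewrite in_itv.
  exists (mxvec A); last by apply/matrixP => i j; rewrite mxE mxvecE.
  by move=> k; case/mxvec_indexP: k => i j; rewrite mxvecE in_itv /= -ler_norml.
apply: continuous_compact Kco; apply: continuous_subspaceT.
exact: (@entrywise_continuous _ _ _ _ (fun i j => (ord0, mxvec_index i j))).
Qed.

Lemma continuous_sum (T : topologicalType) (I : Type) (r : seq I)
    (F : I -> T -> R) :
  (forall i, continuous (F i)) -> continuous (fun x => \sum_(i <- r) F i x).
Proof.
move=> Fc x; elim: r => [|i r IHr].
  by under eq_fun do rewrite big_nil; apply: cst_continuous.
by under eq_fun do rewrite big_cons; apply: continuousD; first exact: Fc.
Qed.

Lemma orthogonal_closed d : closed [set A : 'M[R]_d | A^T *m A = 1%:M].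
Proof.
have -> : [set A : 'M[R]_d | A^T *m A = 1%:M] =
    \bigcap_(ij in [set: 'I_d * 'I_d])
      (fun A : 'M[R]_d => \sum_k A k ij.1 * A k ij.2) @^-1`
        [set (1%:M : 'M[R]_d) ij.1 ij.2].
  apply/seteqP; split=> [A /= AA [i j] _ /=|A AA]; rewrite /=.
    by rewrite -AA mxE; apply: eq_bigr => k _; rewrite mxE.
  apply/matrixP => i j; rewrite -(AA (i, j) I) mxE /=.
  by apply: eq_bigr => k _; rewrite mxE.
apply: closed_bigI => -[i j] _ /=.
apply: preimage_closed; last exact: closed_eq.
move=> A _; apply: continuous_sum => k {}A.
by apply: continuousM; apply: coord_continuous.
Qed.

Variable d : nat.

(** Column [j] has norm 1. *)
Lemma orthogonal_entry (A : 'M[R]_d) i j : A^T *m A = 1%:M -> `|A i j| <= 1.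
Proof.
move=> /matrixP/(_ j j); rewrite !mxE eqxx => AA.
rewrite -(ler_pXn2r (n := 2)) ?nnegrE // expr1n real_normK ?num_real //.
rewrite -[leRHS]AA.
rewrite (bigD1 i) //= mxE expr2 lerDl; apply: sumr_ge0 => k _.
by rewrite mxE -expr2 sqr_ge0.
Qed.

(** The orthogonal matrices form a closed subset of a box, hence a compact set, so bounding the
    translation suffices. *)
Lemma euclid_box_compact (b : R) :
  compact [set g : euclid R d | forall i, `|(euclid_val g).1 i ord0| <= b].
Proof.
apply: initial_compact.
have -> : @euclid_val R d @`
    [set g : euclid R d | forall i, `|(euclid_val g).1 i ord0| <= b]
  = [set v : 'cV[R]_d | forall i j, `|v i j| <= b] `*`
    ([set A : 'M[R]_d | forall i j, `|A i j| <= 1] `&`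
     [set A | A^T *m A = 1%:M]).
  apply/seteqP; split=> [_ [g gb <-]|[v A] /= [vb [_ AA]]].
    have /eqP gP := euclidP g; split=> [i j|]; first by rewrite ord1; apply: gb.
    by split=> // i j; apply: orthogonal_entry.
  by move/eqP in AA; exists (@Euclid R d (v, A) AA).
apply: compact_setX; first exact: box_compact.
by apply: compact_closedI; [exact: box_compact|exact: orthogonal_closed].
Qed.

Lemma half_floor_bound (x : R) : `|x + (- Num.floor (x / 2))%:~R *+ 2| <= 2.
Proof.
have := floor_le (x / 2); have := lt_succ_floor (x / 2).
rewrite intrD1 mulrNz; set f := (Num.floor _)%:~R => fx xf.
by rewrite ler_norml mulr2n; apply/andP; split; lra.
Qed.

(** Multiplying [g = (v, A)] on the right by the translation [2z] stays in its coset and changes [v]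
    into [A (A^T v + 2z)]. Choosing [z] to reduce [A^T v] modulo 2 makes every coset meet a fixed
    compact box. *)
Lemma cocompact_of_translations (H : subgroup (euclid R d)) :
  (forall z : 'cV[int]_d, exists2 h, carrier H h &
     euclid_val h = (map_mx intr z *+ 2, 1%:M)) ->
  compact [set: quotient_topology (lcoset_space H)].
Proof.
move=> Htrans.
(* Each coordinate will be a sum of [d] products of an entry of [A], at most 1 in absolute value,
   with a coordinate at most 2. *)
set C := [set g : euclid R d |
  forall i, `|(euclid_val g).1 i ord0| <= (2 * d)%:R].
have -> : [set: quotient_topology (lcoset_space H)]
    = \pi_(quotient_topology (lcoset_space H)) @` C.
  apply/seteqP; split=> [a _|//]; elim/quotW: a => g.
  have /eqP gP := euclidP g.
  set v := (euclid_val g).1; set A := (euclid_val g).2.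
  pose t := A^T *m v; pose z : 'cV[int]_d := \col_i (- Num.floor (t i 0 / 2)).
  have [h Hh hE] := Htrans z.
  exists (g * h)%g; last first.
    apply/eqmodP/asboolP; have [_ _ HV] := subgroupP H.
    by rewrite invgM mulgVK; apply: HV.
  have w_bound i : `|(t + map_mx intr z *+ 2) i 0| <= 2.
    suff -> : (t + map_mx intr z *+ 2) i 0
        = t i 0 + (- Num.floor (t i 0 / 2))%:~R *+ 2.
      exact: half_floor_bound.
    rewrite /z; clear z h Hh hE; move: t => t.
    by rewrite mulr2n !mxE mulr2n.
  have ghE : (euclid_val (g * h)%g).1 = A *m (t + map_mx intr z *+ 2).
    by rewrite /= hE /= mulmxDr mulmxA (mulmx1C gP) mul1mx.
  move=> i; rewrite ghE mxE; apply: le_trans (ler_norm_sum _ _ _) _.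
  have -> : (2 * d)%:R = \sum_(j < d) (2 : R).
    by rewrite sumr_const card_ord mulnC natrM mulr_natl.
  apply: ler_sum => j _; rewrite normrM -[leRHS]mul1r.
  by apply: ler_pM => //; apply: orthogonal_entry.
apply: continuous_compact; last exact: euclid_box_compact.
by apply: continuous_subspaceT; apply: pi_continuous.
Qed.

Lemma discrete_of_integral (H : subgroup (euclid R d)) :
  (forall g, carrier H g -> exists (v : 'cV[int]_d) (A : 'M[int]_d),
     euclid_val g = (map_mx intr v, map_mx intr A)) ->
  isolated (carrier H) = carrier H.
Proof.
move=> Hint; apply/seteqP; split=> [g [/set_mem]|g Hg] //.
split; first exact/mem_set.
(* Distinct integers are at distance at least 1, so the unit ball around [g] isolates it. *)
have int_eq (a b : int) : ball (a%:~R : R) 1 (b%:~R : R) -> a = b.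
  rewrite /ball /= -intrB -intr_norm ltrz1.
  by lia.
exists (@euclid_val R d @^-1` ball (euclid_val g) 1).
  apply: (@initial_continuous _ _ (@euclid_val R d) g).
  exact: nbhsx_ballx.
apply/seteqP; split=> [h [gh Hh]|_ ->]; last by split=> //; apply: ballxx.
have [v [A gE]] := Hint g Hg; have [u [B hE]] := Hint h Hh.
apply/val_inj; move: gh; rewrite /= gE hE => -[[_ uv] [_ AB]].
have <- : v = u.
  by apply/matrixP => i j; apply: int_eq; have := uv i j; rewrite !mxE.
suff -> : B = A by [].
by apply/matrixP => i j; apply/esym/int_eq; have := AB i j; rewrite !mxE.
Qed.

End CompactIsometries.

(** * The lattice of translations *)

Section Translations.
Variables (R : realType) (m : nat).
Local Notation n := m.+2.
Local Notation Q := (braid_quot n).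
Local Notation D := #|{: pairs n}|.
Local Notation p0 := (pair0 m).

Definition pure_trans (k : pure_quot m) : 'cV[R]_D :=
  (euclid_val (braid_quot_iso R m (pure_val k))).1.

Lemma braid_quot_iso_pure k :
  braid_quot_iso R m (pure_val k) = pair_iso (pure_trans k) 1.
Proof.
rewrite /pure_trans; have [z ->] := braid_quot_isoE R (pure_val k).
by rewrite pure_perm.
Qed.

Lemma pair_iso_injl (u v : 'cV[R]_D) (w : 'S_n) :
  pair_iso u w = pair_iso v w -> u = v.
Proof. by move=> /(congr1 (fun g => (euclid_val g).1)). Qed.

Fact pure_trans_nmod : nmod_morphism pure_trans.
Proof.
split=> [|k l]; apply: (@pair_iso_injl _ _ 1).
  by rewrite -braid_quot_iso_pure pair_iso1; apply: gmulf1.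
rewrite -braid_quot_iso_pure [LHS]gmulfM !braid_quot_iso_pure pair_isoM.
by rewrite pair_perm1 perm_mx1 mul1mx mulg1.
Qed.

HB.instance Definition _ :=
  GRing.isNmodMorphism.Build (pure_quot m) 'cV[R]_D pure_trans pure_trans_nmod.

Lemma pure_trans_conj g k : pure_trans (pure_conj g k)
  = (perm_mx (pair_perm (braid_quot_perm n g)^-1) *m pure_trans k)%R.
Proof.
apply: (@pair_iso_injl _ _ 1); rewrite -braid_quot_iso_pure.
rewrite (_ : pure_val (pure_conj g k) = pure_val k ^ g) // gmulfJ.
have [z ->] := braid_quot_isoE R g; rewrite braid_quot_iso_pure conjgE.
rewrite pair_isoV !pair_isoM pair_perm1 perm_mx1 !mul1mx mul1g mulVg.
by rewrite mulmxDr addrCA addNr addr0.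
Qed.

Lemma braid_quot_iso_gen i : (i <= m)%N ->
  braid_quot_iso R m (qgen m i)
    = pair_iso (pair_vec R (mkpair m i i.+1)) (@adj_transp n (inord i)).
Proof.
move=> im; rewrite /qgen /qpi braid_quot_iso_pi braid_iso_gen.
by rewrite /braid_gen_iso inordK.
Qed.

Lemma mkpair01 : mkpair m 0 1 = p0.
Proof. by apply/val_inj; rewrite val_mkpair. Qed.

Lemma pure_trans_twist : pure_trans (pure_twist m) = (pair_vec R p0 *+ 2)%R.
Proof.
apply: (@pair_iso_injl _ _ 1); rewrite -braid_quot_iso_pure.
rewrite (_ : pure_val (pure_twist m) = qgen m 0 * qgen m 0) // gmulfM.
rewrite braid_quot_iso_gen // pair_isoM tperm2 pair_perm_vec adj_transpV.
rewrite pair_act_mkpair // mkpair01 mulr2n.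
congr (pair_iso (_ + pair_vec R _) _).
by rewrite /nswap inordK //= mkpairC mkpair01.
Qed.

(** Conjugation permutes the [A_p] and the basis vectors in the same way, so the case of the twist
    decides all others. *)
Lemma pure_trans_gen p : pure_trans (pure_gen p) = (pair_vec R p *+ 2)%R.
Proof.
have [x <-] := pure_gen_subproof p.
rewrite pure_gen_twist pure_trans_conj pure_trans_twist.
by rewrite mulr2n mulmxDr pair_perm_vec invgK -mulr2n.
Qed.

(** The coefficients can be read off from the translation; this is the lower bound, the independence
    of the [A_p]. *)
Lemma pure_trans_lin z i :
  pure_trans (pure_lin z) i 0%R = ((z (enum_val i))%:~R *+ 2)%R.
Proof.
rewrite /pure_lin raddf_sum summxE (bigD1 (enum_val i)) //= big1 ?addr0.
  rewrite raddfMz /= pure_trans_gen -scaler_int !mxE enum_valK !eqxx.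
  by rewrite mulrDr mulr1 -mulr2n.
move=> p pi; rewrite raddfMz /= pure_trans_gen -scaler_int !mxE.
rewrite (_ : (i == enum_rank p) = false) ?addr0 ?mulr0 //.
by apply: contraNF pi => /eqP ->; rewrite enum_rankK.
Qed.

Lemma pure_lin_inj (z t : pairs n -> int) : pure_lin z = pure_lin t -> z =1 t.
Proof.
move=> /(congr1 pure_trans)/matrixP eq_zt p.
have := eq_zt (enum_rank p) 0%R; rewrite !pure_trans_lin enum_rankK.
by move/eqP; rewrite eqr_pMn2r // => /eqP/intr_inj.
Qed.

Lemma pure_trans_inj k : pure_trans k = 0%R -> k = 0%R.
Proof.
have [z ->] := pure_lin_surj k => /matrixP z0.
rewrite -[RHS]pure_lin0; congr pure_lin; apply/funext => p.
have := z0 (enum_rank p) 0%R; rewrite pure_trans_lin enum_rankK mxE.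
by move/eqP; rewrite mulrn_eq0 /= intr_eq0 => /eqP.
Qed.

(** With two further points [y] and [z], the image of [x] lies in both {x, y} and {x, z}, so it is
    [x]. *)
Lemma pair_act_faithful (w : 'S_n) : (2 < n)%N ->
  (forall p : pairs n, pair_act w p = p) -> w = 1.
Proof.
move=> n2 w_id; apply/permP => x; rewrite perm1.
have w_pair y : x != y -> w x = x \/ w x = y.
  move=> xy; have xy2 : #|[set x; y]%SET| == 2 by rewrite cards2 xy.
  have /(congr1 val)/= := w_id (exist (fun A : {set 'I_n} => #|A| == 2) _ xy2).
  rewrite imsetU1 imset_set1 => /setP/(_ (w x)).
  by rewrite !inE eqxx /= => /esym/orP[]/eqP; [left|right].
have : (1 < #|[set~ x]%SET|)%N by rewrite cardsC1 card_ord.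
case/card_gt1P => y [z [+ + yz]]; rewrite !inE ![_ == x]eq_sym => xy xz.
have [//|wxy] := w_pair y xy; have [//|wxz] := w_pair z xz.
by rewrite -wxy -wxz eqxx in yz.
Qed.

(* For n = 2 the action on pairs is not faithful; instead, a nontrivial x in the
   kernel would make x * sigma_1 a pure element translating by 1, although pure
   elements translate by even vectors. *)
Lemma braid_quot_iso_inj : injective (braid_quot_iso R m).
Proof.
suff ker1 x : braid_quot_iso R m x = 1 -> x = 1.
  move=> x y xy; rewrite -[x](mulgVK y) -[RHS]mul1g; congr (_ * y).
  by apply: ker1; rewrite gmulfM gmulfV xy mulgV.
move=> x1; have [z xz] := braid_quot_isoE R x.
(* A pure element is determined by its translation, so only the pureness of [x] remains. *)
suff px : braid_quot_perm n x = 1.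
  have [k kE] : exists k, x = pure_val k.
    by move/eqP in px; exists (PureQuot px).
  rewrite kE (_ : k = 0%R) //; apply/pure_trans_inj/(@pair_iso_injl _ _ 1).
  by rewrite -braid_quot_iso_pure -kE x1 pair_iso1.
set w := braid_quot_perm n x in xz *.
(* The linear part is the identity; its diagonal entry at [p] being 1 says that [w] fixes [p]. *)
have wp p : pair_act w p = p.
  have := congr1 (fun g => (euclid_val g).2 (enum_rank p) (enum_rank p)) xz.
  rewrite x1 /= !mxE permE /pair_idx enum_rankK eqxx (inj_eq enum_rank_inj).
  by case: eqP => // _ /eqP; rewrite oner_eq0.
have [m0|m_gt0] := posnP m; last first.
  by apply: pair_act_faithful => //; rewrite !ltnS.
apply/eqP; apply: contraT => w1.
have ord2 (y : 'I_n) : y = inord 0 \/ y = inord 1.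
  case: y => -[|[|y]] yn; [left|right|by exfalso; rewrite m0 in yn];
    by apply/val_inj; rewrite /= inordK.
have adjw : w * @adj_transp n (inord 0) = 1.
  have w01 : w (inord 0) != w (inord 1).
    by rewrite (inj_eq perm_inj) -val_eqE /= !inordK.
  have tw0 : @adj_transp n (inord 0) (inord 0) = inord 1.
    by rewrite adj_transp_inord // /nswap inordK.
  have tw1 : @adj_transp n (inord 0) (inord 1) = inord 0.
    by rewrite adj_transp_inord // /nswap inordK.
  have [w0|w0] := ord2 (w (inord 0)); have [w1'|w1'] := ord2 (w (inord 1)).
  - by rewrite w0 w1' eqxx in w01.
  - by case/eqP: w1; apply/permP => y; rewrite perm1; case: (ord2 y) => ->.
  - by apply/permP => y; rewrite perm1 permM; case: (ord2 y) => ->;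
      rewrite ?w0 ?w1'.
  - by rewrite w0 w1' eqxx in w01.
have px0 : braid_quot_perm n (x * qgen m 0) == 1.
  by rewrite gmulfM qgen_perm adjw.
have [t kE] := pure_lin_surj (PureQuot px0).
have := pure_trans_lin t (enum_rank p0); rewrite -kE.
have -> : pure_trans (PureQuot px0) = pair_vec R p0.
  rewrite /pure_trans (_ : pure_val _ = x * qgen m 0) // gmulfM x1 mul1g.
  by rewrite braid_quot_iso_gen // mkpair01.
rewrite enum_rankK mxE !eqxx /= mulr2n -intrD => /eqP.
rewrite (_ : 1%:R = 1%:~R)%R // (inj_eq (@intr_inj R)) => /eqP.
by move: (t _) => a; lia.
Qed.

Lemma pair_iso_even (z : 'cV[int]_D) :
  exists x, braid_quot_iso R m x = pair_iso (map_mx intr z *+ 2)%R 1.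
Proof.
(* Each [A_p] already translates by twice a basis vector, so the coefficients are the coordinates of
   [z]. *)
exists (pure_val (pure_lin (fun p => z (enum_rank p) 0%R))).
rewrite braid_quot_iso_pure; congr pair_iso; apply/matrixP => i j.
by rewrite (ord1 j) pure_trans_lin enum_valK !mulr2n !mxE.
Qed.

End Translations.

Lemma range_subgroup (G K : groupType) (f : UMagmaMorphism.type G K) :
  is_subgroup (range f).
Proof.
split=> [|_ _ [x _ <-] [y _ <-]|_ [x _ <-]].
- by exists 1; rewrite ?gmulf1.
- by exists (x * y); rewrite ?gmulfM.
- by exists x^-1; rewrite ?gmulfV.
Qed.

(** * The short exact sequence and the crystallographic property *)

Section ShortExactSequence.
Variable m : nat.
Local Notation n := m.+2.

Definition pure_lattice (v : 'rV[int]_(n * (n - 1) %/ 2)%N) : braid_quot n :=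
  pure_val (@pure_lin m (fun p =>
    v 0%R (cast_ord (card_pairs n) (enum_rank p)))).

Lemma pure_latticeD : {morph pure_lattice : u v / (u + v)%R >-> u * v}.
Proof.
move=> u v; rewrite -[RHS]/(pure_val (_ + _)%R) -pure_linD; congr pure_val.
by congr pure_lin; apply/funext => p; rewrite mxE.
Qed.

(** Independence is read off from the real translations, which is where [R] enters. *)
Lemma pure_lattice_inj (R : realType) : injective pure_lattice.
Proof.
move=> u v /val_inj/(pure_lin_inj R) uv; apply/matrixP => i j.
rewrite (ord1 i); have := uv (enum_val (cast_ord (esym (card_pairs n)) j)).
by rewrite enum_valK cast_ordKV.
Qed.

Lemma range_pure_lattice :
  range pure_lattice = [set x | braid_quot_perm n x = 1].
Proof.
apply/seteqP; split=> [_ [v _ <-]|x /eqP x1]; first exact: pure_perm.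
have [z xz] := pure_lin_surj (PureQuot x1).
exists (\row_i z (enum_val (cast_ord (esym (card_pairs n)) i)))%R => //.
rewrite -[RHS]/(pure_val (PureQuot x1)) xz; congr (pure_val (pure_lin _)).
by apply/funext => p; rewrite mxE cast_ordK enum_rankK.
Qed.

End ShortExactSequence.

Lemma braid_quot_crystallographic (R : realType) (m : nat) :
  crystallographic R (braid_quot m.+2).
Proof.
set f := braid_quot_iso R m.
exists #|{: pairs m.+2}|, (Subgroup (range_subgroup f)), f.
split=> //; last exact: braid_quot_iso_inj.
split.
  apply: discrete_of_integral => _ [x _ <-].
  have [z ->] := braid_quot_isoE R x.
  by exists z, (perm_mx (pair_perm (braid_quot_perm _ x))); rewrite map_perm_mx.
apply: cocompact_of_translations => z; have [x xE] := pair_iso_even R z.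
by exists (f x); [exists x|rewrite /f xE /= pair_perm1 perm_mx1].
Qed.

Theorem proposition1 (R : realType) (n : nat) (n_ge2 : (2 <= n)%N) :
  (exists iota : 'rV[int]_(n * (n - 1) %/ 2)%N -> braid_quot n,
    [/\ {morph iota : u v / (u + v)%R >-> u * v},
        injective iota,
        range iota = [set x | braid_quot_perm n x = 1] &
        range (braid_quot_perm n) = [set: 'S_n]]) /\
  crystallographic R (braid_quot n).
Proof.
case: n n_ge2 => [|[|m]] // _; split; last exact: braid_quot_crystallographic.
exists (@pure_lattice m); split.
- exact: pure_latticeD.
- exact: pure_lattice_inj R.
- exact: range_pure_lattice.
apply/seteqP; split=> // w _.
by have [x <-] := braid_quot_perm_surj w; exists x.
Qed.
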